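(* Let $G\subset S_N^+$ be a closed quantum subgroup, with fundamental corepresentation $w=(w_{ij})\in M_N(C(G))$. Let $X_N$ be the compact space of $N\times N$ flat magic unitaries, and let $$X_G=\big\{u\in X_N\ \big|\ Tu^{\otimes k}=u^{\otimes l}T,\ \forall k,l\in\mathbb N,\ \forall T\in Hom(w^{\otimes k},w^{\otimes l})\big\}\subset X_N$$ be the closed subspace obtained by using the Tannakian relations for $G$. Then $$\pi_G:C(G)\to M_N(C(X_G)),\qquad w_{ij}\mapsto[u\mapsto u_{ij}]$$ is a well-defined morphism of $C^*$-algebras, and it is the universal flat model for $C(G)$: for every compact space $Y$ and every morphism $\rho:C(G)\to M_N(C(Y))$ such that each $\rho(w_{ij})(y)\in M_N(\mathbb C)$ is a rank $1$ projection, there is a unique continuous map $f:Y\to X_G$ such that $\rho(a)(y)=\pi_G(a)(f(y))$ for all $a\in C(G)$, $y\in Y$.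
   Context: $C(S_N^+)$ is the universal $C^*$-algebra generated by the entries of an $N\times N$ magic matrix, i.e. a matrix of projections summing up to $1$ on each row and each column; with comultiplication $\Delta(w_{ij})=\sum_kw_{ik}\otimes w_{kj}$, counit $\varepsilon(w_{ij})=\delta_{ij}$, antipode $S(w_{ij})=w_{ji}$, this defines a compact quantum group $S_N^+$. A closed quantum subgroup $G\subset S_N^+$ corresponds to a Hopf $C^*$-algebra quotient $C(S_N^+)\to C(G)$ mapping generators to generators $w_{ij}$, where $C(G)$ is the full (universal) version of the algebra, i.e. by Tannakian duality $C(G)$ is the quotient of $C(S_N^+)$ by the relations $Tv^{\otimes k}=v^{\otimes l}T$, for all $k,l\in\mathbb N$ and $T\in Hom(w^{\otimes k},w^{\otimes l})$, where $v$ is the magic matrix of generators of $C(S_N^+)$. A flat magic unitary is a matrix $u=(u_{ij})\in M_N(M_N(\mathbb C))$ whose entries are rank $1$ projections in $M_N(\mathbb C)$ summing up to $1$ on each row and each column; $X_N$ is the set of these, with its natural compact topology. For a square matrix $v=(v_{ij})\in M_N(B)$ over a $C^*$-algebra $B$, $v^{\otimes r}$ is the $N^r\times N^r$ matrix with entries $(v^{\otimes r})_{i_1\ldots i_r,j_1\ldots j_r}=v_{i_1j_1}\cdots v_{i_rj_r}\in B$. $Hom(w^{\otimes k},w^{\otimes l})$ is the space of scalar $N^l\times N^k$ matrices $T$ with $Tw^{\otimes k}=w^{\otimes l}T$. For $u\in X_N$, the relation $Tu^{\otimes k}=u^{\otimes l}T$ is understood in the same way, with $B=M_N(\mathbb C)$.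 The space $X_G$ is allowed to be empty (in which case the target algebra is $0$). *)

(* Defs.v *)
From HB Require Import structures.
From mathcomp Require Import all_boot all_order all_algebra.
From mathcomp Require Import complex.
From mathcomp Require Import all_classical all_reals topology normedtype.
From mathcomp Require Import ring.
Set Implicit Arguments. Unset Strict Implicit. Unset Printing Implicit Defensive.
Import Order.TTheory GRing.Theory Num.Theory.
Import numFieldNormedType.Exports.
Local Open Scope classical_set_scope.
Local Open Scope ring_scope.
Local Open Scope complex_scope.

(* The norm topology on the complex numbers. *)
HB.instance Definition _ (R : realType) := NormedModule.copy R[i] R[i]^o.

Section Modulus.
Variable R : realType.
Implicit Types (z t : R[i]) (e : R).

Definition modc z : R := complex.Re `|z|.

Lemma modcE z : (modc z)%:C = `|z|.
Proof. by rewrite /modc; case: z. Qed.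

Lemma modc_ge0 z : 0 <= modc z.
Proof. by rewrite -ler0c modcE. Qed.

Lemma modc0 : modc 0 = 0.
Proof. by apply: complexI; rewrite modcE normr0. Qed.

Lemma modc0_eq0 z : modc z = 0 -> z = 0.
Proof. by move=> z0; apply/eqP; rewrite -normr_eq0 -modcE z0. Qed.

Lemma modcM z t : modc (z * t) = modc z * modc t.
Proof. by apply: complexI; rewrite rmorphM /= !modcE normrM. Qed.

Lemma modcD z t : modc (z + t) <= modc z + modc t.
Proof. by rewrite -lecR rmorphD /= !modcE ler_normD. Qed.

Lemma modcN z : modc (- z) = modc z.
Proof. by rewrite /modc normrN. Qed.

Lemma modc_conj z : modc (z^*)%C = modc z.
Proof. by case: z => a b; rewrite /modc /= sqrrN. Qed.

Lemma modc_sum I (r : seq I) (P : pred I) (F : I -> R[i]) :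
  modc (\sum_(i <- r | P i) F i) <= \sum_(i <- r | P i) modc (F i).
Proof.
elim/big_rec2: _ => [|i x y Pi h]; first by rewrite modc0.
by apply: (le_trans (modcD _ _)); rewrite lerD2l.
Qed.

Lemma modc_real e : modc e%:C = `|e|.
Proof. by rewrite /modc /= expr0n /= addr0 sqrtr_sqr. Qed.

Lemma Re_le_modc z : `|complex.Re z| <= modc z.
Proof.
case: z => a b; rewrite /modc /= -sqrtr_sqr ler_sqrt ?addr_ge0 ?sqr_ge0 //.
by rewrite lerDl sqr_ge0.
Qed.

Lemma Im_le_modc z : `|complex.Im z| <= modc z.
Proof.
case: z => a b; rewrite /modc /= -sqrtr_sqr ler_sqrt ?addr_ge0 ?sqr_ge0 //.
by rewrite lerDr sqr_ge0.
Qed.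

Lemma modc_le_ReIm z : modc z <= `|complex.Re z| + `|complex.Im z|.
Proof.
case: z => a b /=.
have -> : (a +i* b)%C = a%:C + 'i%C * b%:C :> R[i].
  by rewrite (complexE (a +i* b)).
rewrite (le_trans (modcD _ _)) // modcM !modc_real.
suff -> : modc 'i%C = 1 by rewrite mul1r.
by rewrite /modc /= expr0n /= add0r expr1n sqrtr1.
Qed.

Lemma posc_ex (eps : R[i]) : 0 < eps -> exists2 e : R, 0 < e & eps = e%:C.
Proof.
by case: eps => a b; rewrite ltcE /= => /andP[/eqP -> a0]; exists a.
Qed.

Lemma complex_complete (F : set_system R[i]) :
  ProperFilter F -> cauchy F -> cvg F.
Proof.
move=> FF Fc.
have cF (p : R[i] -> R) : (forall z t, `|p z - p t| <= modc (z - t)) ->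
    cvg (p @ F).
  move=> pl; apply: cauchy_cvg; apply/cauchy_ballP => e e0.
  have /cauchy_ballP /(_ e%:C) := Fc; rewrite ltcR => /(_ e0) [[A B] [/= FA FB]] AB.
  exists (p @` A, p @` B) => /=.
    by split; [apply: filterS FA|apply: filterS FB] => z Az; exists z.
  case=> x y /= [] [z Az <-] [t Bt <-].
  have := AB (z, t) (conj Az Bt); rewrite /= /ball /= -modcE ltcR.
  by apply: le_lt_trans.
have /cvg_ex[a Fa] : cvg (@complex.Re R @ F).
  apply: cF => z t; suff -> : complex.Re z - complex.Re t = complex.Re (z - t) by exact: Re_le_modc.
  by case: z; case: t.
have /cvg_ex[b Fb] : cvg (@complex.Im R @ F).
  apply: cF => z t; suff -> : complex.Im z - complex.Im t = complex.Im (z - t) by exact: Im_le_modc.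
  by case: z; case: t.
apply/cvg_ex; exists (a +i* b)%C; apply/cvg_ballP => _ /posc_ex[e e0 ->].
have e20 : 0 < e / 2 by rewrite divr_gt0.
move/cvg_ballP/(_ _ e20) : Fa; move/cvg_ballP/(_ _ e20) : Fb.
rewrite !near_map; apply: filterS2 => -[c d] /=.
rewrite /ball /= => hb ha; rewrite -modcE ltcR.
apply: (le_lt_trans (modc_le_ReIm _)) => /=.
by rewrite (splitr e) ltrD.
Qed.

End Modulus.

HB.instance Definition _ (R : realType) :=
  Uniform_isComplete.Build R[i] (@complex_complete R).

(* Unital complex *-algebras.  MathComp's [algType] excludes the zero algebra,
   which occurs here as M_N(C(X)) with X empty; the C-linear structure is
   therefore given by the central unit map [scal], with c.a = scal c * a. *)
Record starAlg (R : realType) := StarAlg {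
  star_ring :> pzRingType;
  scal : R[i] -> star_ring;
  star : star_ring -> star_ring;
  scal_zmod_morphism : zmod_morphism scal;
  scal_monoid_morphism : monoid_morphism scal;
  scal_central : forall c a, scal c * a = a * scal c;
  starK : involutive star;
  starD : {morph star : a b / a + b};
  starM : forall a b, star (a * b) = star b * star a;
  star_scal : forall c, star (scal c) = scal c^*
}.
Arguments scal {R _} _.
Arguments star {R _} _.

Record cstarAlg (R : realType) := CStarAlg {
  cstar_star :> starAlg R;
  cnorm : cstar_star -> R;
  cnormD : forall a b, cnorm (a + b) <= cnorm a + cnorm b;
  cnormZ : forall c a, cnorm (scal c * a) = modc c * cnorm a;
  cnorm0_eq0 : forall a, cnorm a = 0 -> a = 0;
  cnormM : forall a b, cnorm (a * b) <= cnorm a * cnorm b;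
  cnorm_star : forall a, cnorm (star a * a) = cnorm a ^+ 2;
  cnorm_complete : forall u : nat -> cstar_star,
    (forall e, 0 < e ->
      exists n, forall p q, (n <= p)%N -> (n <= q)%N -> cnorm (u p - u q) < e) ->
    exists l, forall e, 0 < e ->
      exists n, forall p, (n <= p)%N -> cnorm (u p - l) < e
}.
Arguments cnorm {R _} _.

(* Morphisms of C*-algebras are the unital *-homomorphisms; they are
   automatically contractive. *)
Definition star_morphism (R : realType) (A B : starAlg R) (f : A -> B) : Prop :=
  [/\ zmod_morphism f, monoid_morphism f,
      forall c, f (scal c) = scal c & forall a, f (star a) = star (f a)].

Definition star_antimorphism (R : realType) (A B : starAlg R) (f : A -> B) :
    Prop :=
  [/\ zmod_morphism f, f 1 = 1 /\ (forall a b, f (a * b) = f b * f a),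
      forall c, f (scal c) = scal c & forall a, f (star a) = star (f a)].

Section ComplexStar.
Variable R : realType.
Let conjM (a b : R[i]) : (a * b)^*%C = b^*%C * a^*%C.
Proof. by rewrite rmorphM mulrC. Qed.
Definition complexStar : starAlg R :=
  @StarAlg R R[i] id conjc (fun _ _ => erefl) (conj erefl (fun _ _ => erefl))
    (@mulrC R[i]) (@conjcK R) (rmorphD conjc) conjM (fun _ => erefl).
End ComplexStar.

Section MatrixStar.
Variables (R : realType) (N : nat).
Implicit Types a b : 'M[R[i]]_N.

Definition mxstar a : 'M[R[i]]_N := \matrix_(i, j) (a j i)^*.
Let sclB : zmod_morphism (@scalar_mx R[i] N).
Proof. exact: raddfB. Qed.
Let sclM : monoid_morphism (@scalar_mx R[i] N).
Proof. by split => // x y; exact: scalar_mxM. Qed.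
Let sclC c a : c%:M * a = a * c%:M.
Proof. exact: comm_scalar_mx. Qed.
Let mxstarK : involutive mxstar.
Proof. by move=> a; apply/matrixP => i j; rewrite !mxE conjcK. Qed.
Let mxstarD : {morph mxstar : a b / a + b}.
Proof. by move=> a b; apply/matrixP => i j; rewrite !mxE rmorphD. Qed.
Lemma mxstarM a b : mxstar (a * b) = mxstar b * mxstar a.
Proof.
apply/matrixP => i j; rewrite !mxE rmorph_sum.
by apply: eq_bigr => k _; rewrite !mxE rmorphM mulrC.
Qed.
Let mxstar_scal (c : R[i]) : mxstar c%:M = (c^*)%:M.
Proof.
by apply/matrixP => i j; rewrite !mxE eq_sym; case: eqP => // _; rewrite /= oppr0.
Qed.
Definition matrixStar : starAlg R :=
  StarAlg sclB sclM sclC mxstarK mxstarD mxstarM mxstar_scal.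
End MatrixStar.

(* Compactness without separation: the Hausdorff property plays no role for
   the algebras C(X). *)
HB.mixin Record isCompactSpace X & Topological X := {
  compact_setT : compact [set: X]
}.

#[short(type="compactType")]
HB.structure Definition CompactSpace := {X of Topological X & isCompactSpace X}.

Section ContinuousFunctions.
Variables (R : realType) (X : topologicalType).
Local Notation CX := (continuousType X R[i]).
Implicit Types f g h : CX.

Let add_cts f g : continuous (fun x => f x + g x).
Proof. by move=> x; apply: cvgD; exact: cts_fun. Qed.
Let opp_cts f : continuous (fun x => - f x).
Proof. by move=> x; apply: cvgN; exact: cts_fun. Qed.
Let mul_cts f g : continuous (fun x => f x * g x).
Proof. by move=> x; apply: (@cvgZ _ R[i] _ _ _ f g); exact: cts_fun. Qed.
Let conj_cts f : continuous (fun x => (f x)^*).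
Proof.
move=> x; apply/cvg_ballP => e e0.
have /cvg_ballP/(_ e e0) := @cts_fun _ _ f x; apply: filterS => y /=.
by rewrite /ball /= -rmorphB -!modcE modc_conj.
Qed.

Definition cfun_add f g : CX := mkcts (@add_cts f g).
Definition cfun_opp f : CX := mkcts (@opp_cts f).
Definition cfun_mul f g : CX := mkcts (@mul_cts f g).
Definition cfun_conj f : CX := mkcts (@conj_cts f).

Let addA : associative cfun_add.
Proof. by move=> f g h; apply/continuousEP => x; exact: addrA. Qed.
Let addC : commutative cfun_add.
Proof. by move=> f g; apply/continuousEP => x; exact: addrC. Qed.
Let add0 : left_id (cst 0 : CX) cfun_add.
Proof. by move=> f; apply/continuousEP => x; exact: add0r. Qed.
Let addN : left_inverse (cst 0 : CX) cfun_opp cfun_add.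
Proof. by move=> f; apply/continuousEP => x; exact: addNr. Qed.
HB.instance Definition _ := GRing.isZmodule.Build CX addA addC add0 addN.

Let mulA : associative cfun_mul.
Proof. by move=> f g h; apply/continuousEP => x; exact: mulrA. Qed.
Let mulC : commutative cfun_mul.
Proof. by move=> f g; apply/continuousEP => x; exact: mulrC. Qed.
Let mul1 : left_id (cst 1 : CX) cfun_mul.
Proof. by move=> f; apply/continuousEP => x; exact: mul1r. Qed.
Let mulD : left_distributive cfun_mul cfun_add.
Proof. by move=> f g h; apply/continuousEP => x; exact: mulrDl. Qed.
HB.instance Definition _ :=
  GRing.Zmodule_isComPzRing.Build CX mulA mulC mul1 mulD.

End ContinuousFunctions.

Section MatrixFunctions.
Variables (R : realType) (N : nat) (X : topologicalType).
Local Notation CX := (continuousType X R[i]).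
Local Notation MCX := 'M[CX]_N.
Implicit Types (a b : MCX) (x : X).

Definition mxeval a x : 'M[R[i]]_N := map_mx (fun f : CX => f x) a.

Lemma mxevalP a b : (forall x, mxeval a x = mxeval b x) -> a = b.
Proof.
move=> ab; apply/matrixP => i j; apply/continuousEP => x.
by have /matrixP/(_ i j) := ab x; rewrite !mxE.
Qed.

Lemma cfun_sumE I (r : seq I) (P : pred I) (F : I -> CX) x :
  (\sum_(i <- r | P i) F i : CX) x = \sum_(i <- r | P i) F i x.
Proof. by elim/big_rec2: _ => // i y z Pi <-. Qed.

Lemma mxevalB a b x : mxeval (a - b) x = mxeval a x - mxeval b x.
Proof. by apply/matrixP => i j; rewrite !mxE. Qed.

Lemma mxevalD a b x : mxeval (a + b) x = mxeval a x + mxeval b x.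
Proof. by apply/matrixP => i j; rewrite !mxE. Qed.

Lemma mxevalM a b x : mxeval (a * b) x = mxeval a x * mxeval b x.
Proof.
apply/matrixP => i j; rewrite !mxE cfun_sumE.
by apply: eq_bigr => k _; rewrite !mxE.
Qed.

Definition mxC_scal (c : R[i]) : MCX := (cst c : CX)%:M.
Definition mxC_star a : MCX := \matrix_(i, j) cfun_conj (a j i).

Lemma mxeval_scal c x : mxeval (mxC_scal c) x = c%:M.
Proof. by apply/matrixP => i j; rewrite !mxE; case: eqP. Qed.

Lemma mxeval_star a x : mxeval (mxC_star a) x = mxstar (mxeval a x).
Proof. by apply/matrixP => i j; rewrite !mxE. Qed.

Lemma mxeval1 x : mxeval 1 x = 1.
Proof. by apply/matrixP => i j; rewrite !mxE; case: eqP. Qed.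

Let S := matrixStar R N.
Let sclB : zmod_morphism mxC_scal.
Proof.
by move=> c d; apply: mxevalP => x; rewrite mxevalB !mxeval_scal raddfB.
Qed.
Let sclM : monoid_morphism mxC_scal.
Proof.
split; first by [].
by move=> c d; apply: mxevalP => x; rewrite mxevalM !mxeval_scal scalar_mxM.
Qed.
Let sclC c a : mxC_scal c * a = a * mxC_scal c.
Proof. by apply: mxevalP => x; rewrite !mxevalM !mxeval_scal; exact: comm_scalar_mx. Qed.
Let stK : involutive mxC_star.
Proof. by move=> a; apply: mxevalP => x; rewrite !mxeval_star; exact: (@starK _ S). Qed.
Let stD : {morph mxC_star : a b / a + b}.
Proof.
move=> a b; apply: mxevalP => x; rewrite mxevalD !mxeval_star mxevalD.
exact: (@starD _ S).
Qed.
Let stM a b : mxC_star (a * b) = mxC_star b * mxC_star a.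
Proof. by apply: mxevalP => x; rewrite mxevalM !mxeval_star mxevalM mxstarM. Qed.
Let st_scal c : mxC_star (mxC_scal c) = mxC_scal c^*.
Proof.
apply: mxevalP => x; rewrite mxeval_star !mxeval_scal; exact: (@star_scal _ S).
Qed.
Definition mxCStar : starAlg R := StarAlg sclB sclM sclC stK stD stM st_scal.
End MatrixFunctions.

Section VectorNorm.
Variables (R : realType) (N : nat).
Implicit Types (v w : 'cV[R[i]]_N) (a : 'M[R[i]]_N).

Definition vnorm v : R := Num.sqrt (\sum_i modc (v i 0) ^+ 2).

Lemma sum_modc2_ge0 v : 0 <= \sum_i modc (v i 0) ^+ 2.
Proof. by apply: sumr_ge0 => i _; rewrite sqr_ge0. Qed.

Lemma vnorm_ge0 v : 0 <= vnorm v. Proof. exact: sqrtr_ge0. Qed.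

Lemma vnorm_sqr v : vnorm v ^+ 2 = \sum_i modc (v i 0) ^+ 2.
Proof. by rewrite sqr_sqrtr // sum_modc2_ge0. Qed.

Lemma dot_le v w : modc (\sum_i v i 0 * (w i 0)^*) <= vnorm v * vnorm w.
Proof.
apply: (le_trans (modc_sum _ _ _)).
under eq_bigr do rewrite modcM modc_conj.
rewrite -(@ler_pXn2r _ 2) ?nnegrE ?mulr_ge0 ?vnorm_ge0 //; last first.
  by apply: sumr_ge0 => i _; rewrite mulr_ge0 ?modc_ge0.
rewrite exprMn !vnorm_sqr.
set p := fun i => modc (v i 0); set q := fun i => modc (w i 0).
have H : \sum_i \sum_j (p i * q j - p j * q i) ^+ 2
    = (\sum_i p i ^+ 2) * (\sum_i q i ^+ 2) *+ 2 - (\sum_i p i * q i) ^+ 2 *+ 2.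
  have E1 : (\sum_i p i ^+ 2) * (\sum_i q i ^+ 2)
      = \sum_i \sum_j (p i * q j) ^+ 2.
    rewrite mulr_suml; apply: eq_bigr => i _; rewrite mulr_sumr.
    by apply: eq_bigr => j _; rewrite exprMn.
  have E2 : (\sum_i p i ^+ 2) * (\sum_i q i ^+ 2)
      = \sum_i \sum_j (p j * q i) ^+ 2.
    by rewrite E1 exchange_big.
  have E3 : (\sum_i p i * q i) ^+ 2
      = \sum_i \sum_j (p i * q j) * (p j * q i).
    rewrite expr2 mulr_suml; apply: eq_bigr => i _; rewrite mulr_sumr.
    by apply: eq_bigr => j _; rewrite mulrACA [q i * q j]mulrC mulrACA.
  rewrite !mulr2n {1}E1 E2 E3 -!big_split -!sumrB /=.
  apply: eq_bigr => i _; rewrite -!big_split -!sumrB /=.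
  by apply: eq_bigr => j _; rewrite sqrrB mulr2n addrAC.
have : 0 <= \sum_i \sum_j (p i * q j - p j * q i) ^+ 2.
  by apply: sumr_ge0 => i _; apply: sumr_ge0 => j _; rewrite sqr_ge0.
by rewrite H subr_ge0 lerMn2r.
Qed.

Lemma dot_self v : \sum_i v i 0 * (v i 0)^* = (vnorm v ^+ 2)%:C.
Proof.
rewrite vnorm_sqr raddf_sum; apply: eq_bigr => i _ /=.
case: (v i 0) => a b; rewrite /modc /= sqr_sqrtr ?addr_ge0 ?sqr_ge0 //.
by apply/eqP; rewrite eq_complex /= mulrN opprK -!expr2 mulrN mulrC addNr !eqxx.
Qed.

Lemma modc_le_vnorm v i : modc (v i 0) <= vnorm v.
Proof.
rewrite -(@ler_pXn2r _ 2) ?nnegrE ?modc_ge0 ?vnorm_ge0 // vnorm_sqr.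
by rewrite (bigD1 i) //= lerDl sumr_ge0 // => j _; rewrite sqr_ge0.
Qed.

Lemma vnorm_le_sum v : vnorm v <= \sum_i modc (v i 0).
Proof.
have S0 : 0 <= \sum_i modc (v i 0) by apply: sumr_ge0 => i _; exact: modc_ge0.
rewrite -(@ler_pXn2r _ 2) ?nnegrE ?vnorm_ge0 // vnorm_sqr expr2 mulr_suml.
apply: ler_sum => i _; rewrite expr2 ler_wpM2l ?modc_ge0 //.
by rewrite (bigD1 i) //= lerDl sumr_ge0 // => j _; exact: modc_ge0.
Qed.

Lemma vnorm0 : vnorm 0 = 0.
Proof.
by rewrite /vnorm big1 ?sqrtr0 // => i _; rewrite mxE modc0 expr0n.
Qed.

Lemma vnormZ (c : R[i]) v : vnorm (c *: v) = modc c * vnorm v.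
Proof.
rewrite -[modc c]ger0_norm ?modc_ge0 // -sqrtr_sqr -sqrtrM ?sqr_ge0 //.
congr Num.sqrt; rewrite mulr_sumr.
by apply: eq_bigr => i _; rewrite mxE modcM exprMn.
Qed.

Lemma vnormD v w : vnorm (v + w) <= vnorm v + vnorm w.
Proof.
have [-> |nz] := eqVneq (vnorm (v + w)) 0; first by rewrite addr_ge0 ?vnorm_ge0.
have p0 : 0 < vnorm (v + w) by rewrite lt_neqAle eq_sym nz vnorm_ge0.
rewrite -(ler_pM2r p0) -expr2.
have -> : vnorm (v + w) ^+ 2
    = modc (\sum_i (v + w) i 0 * ((v + w) i 0)^*).
  by rewrite dot_self modc_real ger0_norm ?sqr_ge0.
have E i : (v + w) i 0 * ((v + w) i 0)^*
    = v i 0 * ((v + w) i 0)^* + w i 0 * ((v + w) i 0)^*.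
  by rewrite -mulrDl; congr (_ * _); rewrite mxE.
rewrite (eq_bigr _ (fun i _ => E i)) big_split /= mulrDl.
by rewrite (le_trans (modcD _ _)) // lerD // dot_le.
Qed.

Lemma dot_star a v w :
  \sum_i (a *m v) i 0 * (w i 0)^* = \sum_i v i 0 * ((mxstar a *m w) i 0)^*.
Proof.
under eq_bigr do rewrite mxE mulr_suml.
under [RHS]eq_bigr do rewrite mxE rmorph_sum mulr_sumr.
rewrite exchange_big /=; apply: eq_bigr => j _; apply: eq_bigr => i _.
by rewrite [mxstar a j i]mxE (rmorphM conjc) /= conjcK mulrCA mulrA.
Qed.

Lemma vnorm_mulmx_sum a v :
  vnorm (a *m v) <= (\sum_i \sum_j modc (a i j)) * vnorm v.
Proof.
apply: (le_trans (vnorm_le_sum _)); rewrite mulr_suml; apply: ler_sum => i _.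
rewrite mxE mulr_suml (le_trans (modc_sum _ _ _)) //; apply: ler_sum => j _.
by rewrite modcM ler_wpM2l ?modc_ge0 ?modc_le_vnorm.
Qed.
End VectorNorm.

Section OperatorNorm.
Variables (R : realType) (N : nat) (X : compactType).
Local Notation MCX := 'M[continuousType X R[i]]_N.
Implicit Types (a b : MCX) (x : X) (v : 'cV[R[i]]_N).

(* ||a|| = sup_x ||a(x)||, with the l^2 operator norm on M_N(C); this is 0 when
   X is empty, as [sup set0 = 0]. *)
Definition opnorm a : R :=
  sup [set r | exists x v, vnorm v <= 1 /\ r = vnorm (mxeval a x *m v)].

Lemma cfun_bounded (f : continuousType X R[i]) :
  exists2 K : R, 0 <= K & forall x, modc (f x) <= K.
Proof.
have cm : continuous (fun x => modc (f x)).
  move=> x; apply/cvg_ballP => e e0.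
  have eC : 0 < e%:C :> R[i] by rewrite ltcR.
  have /cvg_ballP/(_ _ eC) := @cts_fun _ _ f x; apply: filterS => y.
  rewrite /ball /= -modcE ltcR; apply: le_lt_trans.
  by rewrite -lecR -modc_real !modcE rmorphB /= !modcE ler_dist_dist.
have : compact (range (fun x => modc (f x))).
  apply: continuous_compact; last exact: compact_setT.
  exact: continuous_subspaceT.
move=> /compact_bounded [M [_ Mb]].
exists (`|M| + 1); first by rewrite addr_ge0.
move=> x; have M1 : M < `|M| + 1 by rewrite (le_lt_trans (ler_norm M)) // ltrDl.
have := Mb _ M1 (modc (f x)) (imageT _ x).
by rewrite /= ger0_norm ?modc_ge0.
Qed.

Lemma mxeval_bounded a :
  exists2 K : R, 0 <= K & forall x v, vnorm (mxeval a x *m v) <= K * vnorm v.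
Proof.
have /choice[K HK] (ij : 'I_N * 'I_N) :
    exists K : R, 0 <= K /\ forall x, modc (a ij.1 ij.2 x) <= K.
  by have [K K0 HK] := cfun_bounded (a ij.1 ij.2); exists K.
exists (\sum_i \sum_j K (i, j)).
  by apply: sumr_ge0 => i _; apply: sumr_ge0 => j _; have [] := HK (i, j).
move=> x v; apply: (le_trans (vnorm_mulmx_sum _ _)).
rewrite ler_wpM2r ?vnorm_ge0 //; apply: ler_sum => i _; apply: ler_sum => j _.
by rewrite mxE; have [_] := HK (i, j); exact.
Qed.

Lemma opnorm_ge a x v : vnorm (mxeval a x *m v) <= opnorm a * vnorm v.
Proof.
have [v0|nz] := eqVneq (vnorm v) 0.
  by have [K _ /(_ x v)] := mxeval_bounded a; rewrite v0 !mulr0.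
have p0 : 0 < vnorm v by rewrite lt_neqAle eq_sym nz vnorm_ge0.
rewrite -ler_pdivrMr //.
have -> : vnorm (mxeval a x *m v) / vnorm v
    = vnorm (mxeval a x *m ((vnorm v)^-1%:C *: v)).
  by rewrite -scalemxAr vnormZ modc_real ger0_norm ?invr_ge0 ?vnorm_ge0 // mulrC.
apply: ub_le_sup; last first.
  exists x, ((vnorm v)^-1%:C *: v); split => //.
  by rewrite vnormZ modc_real ger0_norm ?invr_ge0 ?vnorm_ge0 // mulVf.
have [K K0 HK] := mxeval_bounded a; exists K => _ [y [w [w1 ->]]].
by rewrite (le_trans (HK _ _)) // ler_piMr.
Qed.

Lemma opnorm_le a (K : R) : 0 <= K ->
  (forall x v, vnorm (mxeval a x *m v) <= K * vnorm v) -> opnorm a <= K.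
Proof.
move=> K0 HK; have [S0|] := pselect
  ([set r | exists x v, vnorm v <= 1 /\ r = vnorm (mxeval a x *m v)] !=set0).
  apply: ge_sup => // _ [y [w [w1 ->]]].
  by rewrite (le_trans (HK _ _)) // ler_piMr.
by move=> S0; rewrite /opnorm sup_out // => -[].
Qed.

Lemma opnorm_ge0 a : 0 <= opnorm a.
Proof.
have [[x _]|nx] := pselect (exists x : X, True).
  apply: (le_trans (vnorm_ge0 (mxeval a x *m 0))).
  apply: ub_le_sup; last by exists x, 0; rewrite vnorm0.
  have [K K0 HK] := mxeval_bounded a; exists K => _ [y [w [w1 ->]]].
  by rewrite (le_trans (HK _ _)) // ler_piMr.
by rewrite /opnorm sup_out // => -[] [_ [x _]] _; apply: nx; exists x.
Qed.

Lemma opnorm_entry a x i j : modc (a i j x) <= opnorm a.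
Proof.
have := opnorm_ge a x (delta_mx j 0).
have -> : vnorm (delta_mx j 0 : 'cV[R[i]]_N) = 1.
  rewrite /vnorm (bigD1 j) //= big1 => [|k /negPf kj].
    by rewrite mxE !eqxx addr0 modc_real normr1 expr1n sqrtr1.
  by rewrite mxE kj modc0 expr0n.
rewrite mulr1; apply: le_trans; rewrite -colE.
by apply: le_trans (modc_le_vnorm _ i); rewrite !mxE.
Qed.

Lemma opnorm_sum a (e : R) : 0 <= e -> (forall x i j, modc (a i j x) <= e) ->
  opnorm a <= N%:R * N%:R * e.
Proof.
move=> e0 ae; apply: opnorm_le; first by rewrite !mulr_ge0.
move=> x v; apply: (le_trans (vnorm_mulmx_sum _ _)).
rewrite ler_wpM2r ?vnorm_ge0 //.
apply: (@le_trans _ _ (\sum_(i < N) \sum_(j < N) e)).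
  by apply: ler_sum => i _; apply: ler_sum => j _; rewrite mxE.
by rewrite !sumr_const !card_ord -mulrA !mulr_natl.
Qed.

Let opD a b : opnorm (a + b) <= opnorm a + opnorm b.
Proof.
apply: opnorm_le; first by rewrite addr_ge0 ?opnorm_ge0.
move=> x v; rewrite mxevalD mulmxDl mulrDl (le_trans (vnormD _ _)) //.
by rewrite lerD ?opnorm_ge.
Qed.

Let opM a b : opnorm (a * b) <= opnorm a * opnorm b.
Proof.
apply: opnorm_le; first by rewrite mulr_ge0 ?opnorm_ge0.
move=> x v; rewrite mxevalM -mulmxA (le_trans (opnorm_ge _ _ _)) //.
by rewrite -mulrA ler_wpM2l ?opnorm_ge0 ?opnorm_ge.
Qed.

Let op0 a : opnorm a = 0 -> a = 0.
Proof.
move=> a0; apply/matrixP => i j; apply/continuousEP => x; rewrite mxE.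
by apply: modc0_eq0; apply/eqP; rewrite eq_le modc_ge0 -a0 opnorm_entry.
Qed.

Let opZ (c : R[i]) a : opnorm (mxC_scal N X c * a) = modc c * opnorm a.
Proof.
have E d b x v : vnorm (mxeval (mxC_scal N X d * b) x *m v)
    = modc d * vnorm (mxeval b x *m v).
  by rewrite mxevalM mxeval_scal -[_ * _]/(_ *m _) mul_scalar_mx -scalemxAl vnormZ.
apply/eqP; rewrite eq_le; apply/andP; split.
  apply: opnorm_le => [|x v]; first by rewrite mulr_ge0 ?modc_ge0 ?opnorm_ge0.
  by rewrite E -mulrA ler_wpM2l ?modc_ge0 ?opnorm_ge.
have [->|c0] := eqVneq c 0; first by rewrite modc0 mul0r opnorm_ge0.
have pc : 0 < modc c.
  rewrite lt_neqAle modc_ge0 andbT eq_sym; apply: contra c0 => /eqP z.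
  exact/eqP/modc0_eq0.
rewrite -ler_pdivlMl //; apply: opnorm_le => [|x v].
  by rewrite mulr_ge0 ?invr_ge0 ?modc_ge0 ?opnorm_ge0.
by rewrite -mulrA ler_pdivlMl // -E opnorm_ge.
Qed.

Let op_star a : opnorm (mxC_star a * a) = opnorm a ^+ 2.
Proof.
have L b : opnorm b ^+ 2 <= opnorm (mxC_star b * b).
  rewrite -[leRHS]sqr_sqrtr ?opnorm_ge0 // ler_sqr ?nnegrE ?opnorm_ge0 ?sqrtr_ge0 //.
  apply: opnorm_le => [|x v]; first exact: sqrtr_ge0.
  rewrite -(@ler_pXn2r _ 2) ?nnegrE ?mulr_ge0 ?sqrtr_ge0 ?vnorm_ge0 //.
  rewrite exprMn [Num.sqrt (opnorm _) ^+ 2]sqr_sqrtr ?opnorm_ge0 //.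
  have -> : vnorm (mxeval b x *m v) ^+ 2
      = modc (vnorm (mxeval b x *m v) ^+ 2)%:C.
    by rewrite modc_real ger0_norm ?sqr_ge0.
  rewrite -dot_self dot_star.
  apply: (le_trans (dot_le _ _)); rewrite expr2 mulrCA ler_wpM2l ?vnorm_ge0 //.
  by rewrite mulmxA -mxeval_star -[_ *m mxeval b x]mxevalM opnorm_ge.
have S b : opnorm b <= opnorm (mxC_star b).
  have [->|nz] := eqVneq (opnorm b) 0; first exact: opnorm_ge0.
  have p0 : 0 < opnorm b by rewrite lt_neqAle eq_sym nz opnorm_ge0.
  have H := le_trans (L b) (opM (mxC_star b) b).
  by rewrite expr2 (ler_pM2r p0) in H.
apply/eqP; rewrite eq_le L andbT expr2; apply: (le_trans (opM _ _)).
apply: ler_wpM2r; first exact: opnorm_ge0.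
have := S (mxC_star a).
by have -> : mxC_star (mxC_star a) = a by exact: (@starK _ (mxCStar R N X)).
Qed.

Let op_complete (u : nat -> MCX) :
  (forall e, 0 < e ->
    exists n, forall p q, (n <= p)%N -> (n <= q)%N -> opnorm (u p - u q) < e) ->
  exists l, forall e, 0 < e ->
    exists n, forall p, (n <= p)%N -> opnorm (u p - l) < e.
Proof.
move=> uc.
have /choice[l Hl] (ijx : 'I_N * 'I_N * X) : exists z : R[i],
    (fun n => u n ijx.1.1 ijx.1.2 ijx.2) @ \oo --> z.
  apply/cvg_ex; apply: cauchy_cvg; apply/cauchy_ballP => _ /posc_ex[e e0 ->].
  have [n Hn] := uc e e0.
  pose V := [set u p ijx.1.1 ijx.1.2 ijx.2 | p in [set p | (n <= p)%N]].
  exists (V, V) => /=.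
    by split; exists n => // p /= np; exists p.
  case=> _ _ /= [[p np <-] [q nq <-]]; rewrite /ball /= -modcE ltcR.
  apply: le_lt_trans (Hn p q np nq).
  by apply: le_trans (opnorm_entry _ ijx.2 ijx.1.1 ijx.1.2); rewrite !mxE.
have ul e : 0 < e -> exists n, forall p, (n <= p)%N ->
    forall i j x, modc (u p i j x - l (i, j, x)) <= e.
  move=> e0; have e20 : 0 < e / 2 by rewrite divr_gt0.
  have [n Hn] := uc _ e20; exists n => p np i j x.
  have eC : 0 < (e / 2)%:C :> R[i] by rewrite ltcR.
  have /cvg_ballP/(_ _ eC) [m _ Hm] := Hl (i, j, x).
  have := Hm (maxn n m) (leq_maxr _ _); rewrite /ball /= -modcE ltcR => h1.
  have h2 : modc (u p i j x - u (maxn n m) i j x) <= e / 2.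
    apply/ltW/(le_lt_trans _ (Hn p (maxn n m) np (leq_maxl _ _))).
    by apply: le_trans (opnorm_entry _ x i j); rewrite !mxE.
  rewrite -(subrKA (u (maxn n m) i j x)) (le_trans (modcD _ _)) // (splitr e).
  by rewrite lerD // -modcN opprB ltW.
have lc i j : continuous (fun x => l (i, j, x)).
  move=> x; apply/cvg_ballP => _ /posc_ex[e e0 ->].
  have e40 : 0 < e / 4 by rewrite divr_gt0.
  have [n /(_ n (leqnn n)) Hn] := ul _ e40.
  have eC : 0 < (e / 4)%:C :> R[i] by rewrite ltcR.
  have /cvg_ballP/(_ _ eC) := @cts_fun _ _ (u n i j) x; apply: filterS => y.
  rewrite /ball /= -!modcE !ltcR => h.
  have -> : l (i, j, x) - l (i, j, y) = - (u n i j x - l (i, j, x))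
    + (u n i j x - u n i j y) + (u n i j y - l (i, j, y)).
    by ring.
  apply: (le_lt_trans (modcD _ _)); apply: (le_lt_trans (lerD (modcD _ _) (Hn _ _ _))).
  rewrite modcN; apply: (le_lt_trans (lerD (lerD (Hn _ _ _) (ltW h)) (lexx _))).
  have E : e = e / 4 + e / 4 + e / 4 + e / 4 by field.
  by rewrite [ltRHS]E ltrDl.
exists (\matrix_(i, j) (mkcts (lc i j) : continuousType X R[i])) => e e0.
pose d : R := e / (N%:R * N%:R + 1).
have D0 : 0 < N%:R * N%:R + 1 :> R by rewrite ltr_wpDl ?mulr_ge0.
have d0 : 0 < d by rewrite divr_gt0.
have [n Hn] := ul d d0; exists n => p np.
apply: (@le_lt_trans _ _ (N%:R * N%:R * d)).
  by apply: opnorm_sum => [|x i j]; [exact: ltW|rewrite !mxE; exact: Hn].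
by rewrite /d mulrA ltr_pdivrMr // mulrC ltr_pM2l // ltrDl.
Qed.

(* The C*-algebra M_N(C(X)). *)
Definition mxC : cstarAlg R :=
  @CStarAlg R (mxCStar R N X) opnorm opD opZ op0 opM op_star op_complete.
End OperatorNorm.

Section MagicUnitaries.
Variables (R : realType) (N : nat).

Definition is_projection (B : starAlg R) (p : B) : Prop :=
  p * p = p /\ star p = p.

Definition is_magic (B : starAlg R) (v : 'M[B]_N) : Prop :=
  [/\ forall i j, is_projection (v i j),
      forall i, \sum_j v i j = 1 & forall j, \sum_i v i j = 1].

Definition rank1_projection (p : 'M[R[i]]_N) : Prop :=
  @is_projection (matrixStar R N) p /\ \rank p = 1%N.

Definition flat_magic_unitaries : set 'M['M[R[i]]_N]_N :=
  [set u | @is_magic (matrixStar R N) u /\ forall i j, rank1_projection (u i j)].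

(* Rows and columns are indexed by the N^r tuples of indices, in the order given
   by [enum_val]; the products are ordered. *)
Definition tensor_power (B : pzRingType) (v : 'M[B]_N) (r : nat) :
    'M[B]_#|{: r.-tuple 'I_N}| :=
  \matrix_(p, q) \prod_(s < r) v (tnth (enum_val p) s) (tnth (enum_val q) s).

Definition hom_defect (B : starAlg R) (v : 'M[B]_N) (k l : nat)
    (T : 'M[R[i]]_(#|{: l.-tuple 'I_N}|, #|{: k.-tuple 'I_N}|)) :
    'M[B]_(#|{: l.-tuple 'I_N}|, #|{: k.-tuple 'I_N}|) :=
  map_mx scal T *m tensor_power v k - tensor_power v l *m map_mx scal T.

Definition Hom (B : starAlg R) (v : 'M[B]_N) (k l : nat) :
    set 'M[R[i]]_(#|{: l.-tuple 'I_N}|, #|{: k.-tuple 'I_N}|) :=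
  [set T | map_mx scal T *m tensor_power v k
           = tensor_power v l *m map_mx scal T].
Arguments Hom [B] v k l _.

Definition XG (A : starAlg R) (w : 'M[A]_N) : set 'M['M[R[i]]_N]_N :=
  [set u | flat_magic_unitaries u /\
    forall k l, Hom w k l `<=` @Hom (matrixStar R N) u k l].

End MagicUnitaries.
Arguments Hom [R N B] v k l _.
Arguments hom_defect [R N B] v [k l] T.

Section CompactXG.
Variables (R : realType) (N : nat).
Local Notation W := 'M['M[R[i]]_N]_N.
Local Notation CW := (continuousType W R[i]).

Lemma mx_continuous (S T : topologicalType) m n (f : S -> 'M[T]_(m, n)) :
  (forall i j, continuous (fun x => f x i j)) -> continuous f.
Proof.
move=> fc x A [P HP sPA].
have : \forall y \near x, forall ij : 'I_m * 'I_n, P ij.1 ij.2 (f y ij.1 ij.2).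
  by apply: filter_forall => -[i j] /=; exact: fc (HP i j).
by apply: filterS => y H; apply: sPA => i j; exact: H (i, j).
Qed.

Lemma coord_mx_continuous (T : topologicalType) m n i j :
  continuous (fun M : 'M[T]_(m, n) => M i j).
Proof.
move=> M A MA; exists (fun i' j' => if (i' == i) && (j' == j) then A else setT).
  by move=> i' j'; case: ifP => [/andP[/eqP-> /eqP->]|_] //; exact: filterT.
by move=> M' /(_ i j); rewrite !eqxx.
Qed.

Lemma complex_pair_continuous (T : topologicalType) (p q : T -> R) :
  continuous p -> continuous q -> continuous (fun x => (p x +i* q x)%C).
Proof.
move=> cp cq x; apply/cvg_ballP => _ /posc_ex[e e0 ->].
have e20 : 0 < e / 2 by rewrite divr_gt0.
have /cvg_ballP/(_ _ e20) := cp x; have /cvg_ballP/(_ _ e20) := cq x.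
apply: filterS2 => y; rewrite /ball /= => hq hp; rewrite -modcE ltcR.
by rewrite (le_lt_trans (modc_le_ReIm _)) //= (splitr e) ltrD.
Qed.

Let coord_cts i j a b : continuous (fun u : W => u i j a b).
Proof.
move=> u; apply: (@continuous_comp _ _ _ (fun u : W => u i j) (fun p => p a b)).
  exact: coord_mx_continuous.
exact: coord_mx_continuous.
Qed.

Let U : 'M['M[CW]_N]_N := \matrix_(i, j) \matrix_(a, b) (mkcts (@coord_cts i j a b) : CW).

Let evU i j (u : W) : mxeval (U i j) u = u i j.
Proof. by apply/matrixP => a b; rewrite !mxE. Qed.

Let closed0 (f : CW) : closed [set u | f u = 0].
Proof.
rewrite -[X in closed X]/(f @^-1` [set 0]).
apply: preimage_closed; first by move=> u _; exact: cts_fun.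
apply: accessible_closed_set1; apply: hausdorff_accessible.
exact: (@norm_hausdorff _ R[i]).
Qed.

Let closed_mx0 (F : 'M[CW]_N) : closed [set u | mxeval F u = 0].
Proof.
rewrite [X in closed X](_ : _ =
    \bigcap_(ij in [set: 'I_N * 'I_N]) [set u | F ij.1 ij.2 u = 0]).
  by apply: closed_bigI => ij _; exact: closed0.
apply/seteqP; split => u /= H.
  by move=> [i j] _ /=; move/matrixP: H => /(_ i j); rewrite !mxE.
by apply/matrixP => i j; rewrite !mxE; exact: (H (i, j)).
Qed.

Let closed_mx_eq (F H : 'M[CW]_N) : closed [set u | mxeval F u = mxeval H u].
Proof.
rewrite [X in closed X](_ : _ = [set u | mxeval (F - H) u = 0]) //.
apply/seteqP; split => u /=; rewrite mxevalB; first by move=> ->; exact: subrr.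
by move/eqP; rewrite subr_eq0 => /eqP.
Qed.

Lemma closed_forall (I : Type) (T : topologicalType) (P : I -> T -> Prop) :
  (forall i, closed [set u | P i u]) -> closed [set u | forall i, P i u].
Proof.
move=> cP; rewrite [X in closed X](_ : _ = \bigcap_(i in setT) [set u | P i u]).
  by apply: closed_bigI => i _.
by apply/seteqP; split => u H i; [move=> _; exact: H|exact: (H i Logic.I)].
Qed.

Let mxeval_sum (I : finType) (F : I -> 'M[CW]_N) u :
  mxeval (\sum_i F i) u = \sum_i mxeval (F i) u.
Proof.
apply: (big_morph (fun a => mxeval a u)) => [a b|]; first exact: mxevalD.
by apply/matrixP => i j; rewrite !mxE.
Qed.

Lemma rank1_idempotentP (p : 'M[R[i]]_N) : p *m p = p ->
  \rank p = 1%N <->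
  \tr p = 1 /\ forall i j a b, p i j * p a b = p i b * p a j.
Proof.
move=> pp; split.
  move=> r1; have := mulmx_base p; move: (col_base p) (row_base p).
  rewrite r1 => c r crE.
  have minors i j a b : p i j * p a b = p i b * p a j.
    by rewrite -crE !mxE !big_ord1; ring.
  split=> //.
  have trE : \tr p = (r *m c) 0 0 by rewrite -crE mxtrace_mulC /mxtrace big_ord1.
  have : (r *m c) 0 0 *: p = p.
    have cr1 : c *m (r *m c) = (r *m c) 0 0 *: c.
      by rewrite {1}[r *m c]mx11_scalar mul_mx_scalar.
    by rewrite -[in RHS]pp -crE mulmxA -[c *m r *m c]mulmxA cr1 -scalemxAl.
  have : p != 0 by rewrite -mxrank_eq0 r1.
  rewrite -trE => p0 trp; apply/eqP; rewrite -subr_eq0.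
  have : (\tr p - 1) *: p == 0 by rewrite scalerBl scale1r trp subrr.
  by rewrite scaler_eq0 (negPf p0) orbF.
case=> tr1 minors.
have p0 : p != 0.
  by apply/eqP => p0; move: tr1; rewrite p0 mxtrace0 => /eqP; rewrite eq_sym oner_eq0.
have [[i j] pij] : exists ij : 'I_N * 'I_N, p ij.1 ij.2 != 0.
  apply/existsP; apply: contraNT p0; rewrite negb_exists => /forallP p0.
  by apply/eqP/matrixP => i j; rewrite mxE; apply/eqP; move: (p0 (i, j)); rewrite negbK.
have pE : p = col j p *m ((p i j)^-1 *: row i p).
  apply/matrixP => a b; rewrite !mxE big_ord1 !mxE mulrCA.
  by rewrite -minors mulrCA mulVf ?mulr1 // mulrC.
apply/eqP; rewrite eqn_leq lt0n mxrank_eq0 p0 andbT.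
by rewrite pE (leq_trans (mxrankM_maxl _ _)) // rank_leq_col.
Qed.

Lemma hom_defect_morph (A B : starAlg R) (f : A -> B) (v : 'M[A]_N) k l T p q :
  star_morphism f ->
  hom_defect (map_mx f v) T p q = f (@hom_defect R N A v k l T p q).
Proof.
move=> [fB [f1 fM] fs _].
have f0 : f 0 = 0 by rewrite -[X in f X](subrr 0) fB subrr.
have fD a b : f (a + b) = f a + f b.
  by rewrite -[in LHS](opprK b) fB -[- b]add0r fB f0 sub0r opprK.
have fsum (I : finType) (F : I -> A) : f (\sum_i F i) = \sum_i f (F i).
  exact: big_morph.
have ft r i j : tensor_power (map_mx f v) r i j = f (tensor_power v r i j).
  rewrite !mxE (big_morph f fM f1); by apply: eq_bigr => s _; rewrite mxE.
rewrite !mxE fB !fsum; congr (_ - _); apply: eq_bigr => s _.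
  by rewrite fM ft !mxE fs.
by rewrite fM ft !mxE fs.
Qed.

Lemma HomE (B : starAlg R) (v : 'M[B]_N) k l T :
  Hom v k l T <-> forall p q, hom_defect v T p q = 0.
Proof.
rewrite /Hom /hom_defect /=; split.
  by move=> TE p q; rewrite TE !mxE subrr.
by move=> H; apply/eqP; rewrite -subr_eq0; apply/eqP/matrixP => p q; rewrite H mxE.
Qed.

Lemma mxeval_morphism (X : topologicalType) (x : X) :
  @star_morphism R (mxCStar R N X) (matrixStar R N) (fun a => mxeval a x).
Proof.
split; first by move=> a b; exact: mxevalB.
- by split; [exact: mxeval1|move=> a b; exact: mxevalM].
- by move=> c; exact: mxeval_scal.
- by move=> a; exact: mxeval_star.
Qed.

Lemma closed_XG (A : starAlg R) (w : 'M[A]_N) : closed (XG w).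
Proof.
have mapU (u : W) : map_mx (fun a => mxeval a u) U = u.
  by apply/matrixP => i j; rewrite mxE evU.
rewrite [X in closed X](_ : _ = [set u : W |
  (forall i j, u i j *m u i j = u i j)] `&`
  [set u : W | forall i j, mxstar (u i j) = u i j] `&`
  [set u : W | forall i, \sum_j u i j = 1] `&`
  [set u : W | forall j, \sum_i u i j = 1] `&`
  [set u : W | forall i j, \tr (u i j) = 1] `&`
  [set u : W | forall i j a b c d,
     u i j a b * u i j c d = u i j a d * u i j c b] `&`
  [set u : W | forall k l T p q, Hom w k l T ->
     @hom_defect R N (matrixStar R N) u k l T p q = 0]); last first.
  apply/seteqP; split => u.
    case=> -[[P1 P2 P3] P4] P5.
    have pp i j : u i j *m u i j = u i j by have [] := P1 i j.
    have r1 i j : \rank (u i j) = 1%N by have [] := P4 i j.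
    do !split => //=.
    - by move=> i j; have [] := P1 i j.
    - by move=> i j; have /(rank1_idempotentP (pp i j))[] := r1 i j.
    - by move=> i j a b c d; have /(rank1_idempotentP (pp i j))[_] := r1 i j; exact.
    - by move=> k l T p q /P5 /HomE; exact.
  case=> -[] [] [] [] [] /= P1 P2 P3 P4 P5 P6 P7.
  split; last by move=> k l T TH; apply/HomE => p q; exact: P7.
  split; first by split => // i j; split; [exact: P1|exact: P2].
  by move=> i j; split; [split; [exact: P1|exact: P2]|apply/rank1_idempotentP].
have cE (P Q : W -> 'M[R[i]]_N) (F H : 'M[CW]_N) :
    (forall u, mxeval F u = P u) -> (forall u, mxeval H u = Q u) ->
    closed [set u | P u = Q u].
  move=> FP HQ; rewrite [X in closed X](_ : _ = [set u | mxeval F u = mxeval H u]) //.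
  by apply/seteqP; split => u /=; rewrite FP HQ.
have cS (P Q : W -> R[i]) (F H : CW) :
    (forall u, F u = P u) -> (forall u, H u = Q u) -> closed [set u | P u = Q u].
  move=> FP HQ; rewrite [X in closed X](_ : _ = [set u | (F - H : CW) u = 0]) //.
  have E u : (F - H : CW) u = P u - Q u by rewrite -FP -HQ.
  apply/seteqP; split => u /=; rewrite E; first by move=> ->; exact: subrr.
  by move/eqP; rewrite subr_eq0 => /eqP.
do ![apply: closedI].
- apply: closed_forall => i; apply: closed_forall => j.
  apply: (cE _ _ (U i j * U i j) (U i j)) => u; last exact: evU.
  by rewrite mxevalM evU.
- apply: closed_forall => i; apply: closed_forall => j.
  apply: (cE _ _ (mxC_star (U i j)) (U i j)) => u; last exact: evU.
  by rewrite mxeval_star evU.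
- apply: closed_forall => i.
  apply: (cE _ _ (\sum_j U i j) 1) => u; last exact: mxeval1.
  by rewrite mxeval_sum; apply: eq_bigr => j _; rewrite evU.
- apply: closed_forall => j.
  apply: (cE _ _ (\sum_i U i j) 1) => u; last exact: mxeval1.
  by rewrite mxeval_sum; apply: eq_bigr => i _; rewrite evU.
- apply: closed_forall => i; apply: closed_forall => j.
  apply: (cS _ _ (\tr (U i j)) 1) => u //.
  by rewrite cfun_sumE; apply: eq_bigr => a _; rewrite !mxE.
- do 6![apply: closed_forall => ?].
  by apply: (cS _ _ (U _ _ _ _ * U _ _ _ _) (U _ _ _ _ * U _ _ _ _)) => u;
    rewrite !mxE.
- apply: closed_forall => k; apply: closed_forall => l; apply: closed_forall => T.
  apply: closed_forall => p; apply: closed_forall => q; apply: closed_forall => _.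
  apply: (cE _ _ (@hom_defect R N (mxCStar R N W) U k l T p q) 0) => u.
    by rewrite -(hom_defect_morph _ _ _ _ (mxeval_morphism u)) mapU.
  by apply/matrixP => a b; rewrite !mxE.
Qed.

Lemma projection_entry_le1 (p : 'M[R[i]]_N) a b :
  p *m p = p -> mxstar p = p -> modc (p a b) <= 1.
Proof.
move=> pp ps.
have pba i j : p j i = (p i j)^* by rewrite -[in LHS]ps mxE.
have dE i : p i i = (\sum_k modc (p i k) ^+ 2)%:C.
  rewrite -{1}pp mxE raddf_sum; apply: eq_bigr => k _ /=.
  rewrite (pba i k); case: (p i k) => x y; rewrite /modc /= sqr_sqrtr ?addr_ge0 ?sqr_ge0 //.
  by apply/eqP; rewrite eq_complex /= mulrN opprK -!expr2 mulrN mulrC addNr !eqxx.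
have le i k : modc (p i k) ^+ 2 <= modc (p i i).
  rewrite dE modc_real ger0_norm ?sumr_ge0 // => [|k' _]; last exact: sqr_ge0.
  by rewrite (bigD1 k) //= lerDl sumr_ge0 // => k' _; exact: sqr_ge0.
have d1 i : modc (p i i) <= 1.
  have := le i i; rewrite expr2; have := modc_ge0 (p i i).
  rewrite le_eqVlt => /orP[/eqP <-//|p0]; by rewrite ger_pMl.
by rewrite -(@expr_le1 _ 2) ?modc_ge0 // (le_trans (le a b)).
Qed.

Lemma compact_XG (A : starAlg R) (w : 'M[A]_N) : compact (XG w).
Proof.
pose I := ('I_N * 'I_N * 'I_N * 'I_N * bool)%type.
pose box := [set f : prod_topology (fun _ : I => R) | forall t, `[(-1 : R), 1]%classic (f t)].
have cbox : compact box.
  exact: (@tychonoff I (fun=> R) (fun=> `[(-1 : R), 1]%classic) (fun=> @segment_compact R _ _)).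
pose g (f : prod_topology (fun _ : I => R)) : W := \matrix_(i, j) \matrix_(a, b)
   (f (i, j, a, b, true) +i* f (i, j, a, b, false))%C.
have cg : continuous g.
  apply: mx_continuous => i j; apply: mx_continuous => a b f.
  have gE : (fun h => g h i j a b) =
      (fun h => (h (i, j, a, b, true) +i* h (i, j, a, b, false))%C).
    by apply/funext => h; rewrite /g mxE mxE.
  rewrite gE; move: f; apply: complex_pair_continuous.
    exact: (@proj_continuous I (fun _ => R) (i, j, a, b, true)).
  exact: (@proj_continuous I (fun _ => R) (i, j, a, b, false)).
have cK : compact (g @` box).
  by apply: continuous_compact => //; exact: continuous_subspaceT.
apply: (subclosed_compact (@closed_XG A w) cK) => u -[] [] [] P _ _ _ _.
exists (fun t : I => if t.2 then complex.Re (u t.1.1.1.1 t.1.1.1.2 t.1.1.2 t.1.2)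
   else complex.Im (u t.1.1.1.1 t.1.1.1.2 t.1.1.2 t.1.2)).
  move=> [[[[i j] a] b] c] /=; rewrite in_itv /= -ler_norml.
  have [pp ps] := P i j; have := projection_entry_le1 a b pp ps.
  by case: c; apply: le_trans; [exact: Re_le_modc|exact: Im_le_modc].
by apply/matrixP => i j; apply/matrixP => a b; rewrite !mxE /=; case: (u i j a b).
Qed.

Lemma compact_set_type (T : topologicalType) (A : set T) :
  compact A -> compact [set: set_type A].
Proof.
move=> cA F FF _.
have FA : (set_val @ F) A.
  rewrite /fmap /= /nbhs /= (_ : _ @^-1` A = setT); first exact: filterT.
  by apply/seteqP; split => // -[x xA] _; exact: set_mem.
have [p [Ap clp]] := cA _ _ FA.
exists (exist _ p (mem_set Ap) : set_type A); split => // B V FB.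
case=> _ [[O oO <-]] /= Op OV.
have FB' : F (set_val @^-1` (set_val @` B)).
  by apply: (filterS _ FB) => x Bx; exists x.
have [_ [[x Bx <-] Ox]] := clp _ _ FB' (open_nbhs_nbhs (conj oO Op)).
by exists x; split => //; exact: OV.
Qed.

Definition XG_space (A : starAlg R) (w : 'M[A]_N) : Type := set_type (XG w).
HB.instance Definition _ (A : starAlg R) (w : 'M[A]_N) :=
  Topological.copy (XG_space w) (set_type (XG w)).
HB.instance Definition _ (A : starAlg R) (w : 'M[A]_N) :=
  isCompactSpace.Build (XG_space w) (compact_set_type (@compact_XG A w)).

End CompactXG.

(* C(S_N^+) is the C*-algebra [S] with the magic matrix [v]; uniqueness of the
   factorization says that the entries of [v] generate [S]. *)
Definition universal_magic (R : realType) (N : nat) (S : cstarAlg R)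
    (v : 'M[S]_N) : Prop :=
  is_magic v /\
  forall (B : cstarAlg R) (b : 'M[B]_N), is_magic b ->
    exists! phi : S -> B, star_morphism phi /\ forall i j, phi (v i j) = b i j.

(* A C*-algebraic tensor product of A and B: a completion of the algebraic
   tensor product for some C*-norm, with x (x) y = tensl x * tensr y. *)
Record cstarTensor (R : realType) (A B : cstarAlg R) := CStarTensor {
  tens_alg :> cstarAlg R;
  tensl : A -> tens_alg;
  tensr : B -> tens_alg;
  tensl_morphism : star_morphism tensl;
  tensr_morphism : star_morphism tensr;
  tens_comm : forall x y, tensl x * tensr y = tensr y * tensl x;
  tens_faithful : forall n (x : 'I_n -> A) (y : 'I_n -> B),
    (forall c : 'I_n -> R[i], \sum_i scal (c i) * x i = 0 -> forall i, c i = 0) ->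
    \sum_i tensl (x i) * tensr (y i) = 0 -> forall i, y i = 0;
  tens_dense : forall z (e : R), 0 < e ->
    exists n (x : 'I_n -> A) (y : 'I_n -> B),
      cnorm (z - \sum_i tensl (x i) * tensr (y i)) < e
}.
Arguments tensl {R A B} c _.
Arguments tensr {R A B} c _.

Record hopfStructure (R : realType) (N : nat) (A : cstarAlg R) (w : 'M[A]_N) :=
    HopfStructure {
  hopf_tensor : cstarTensor A A;
  comult : A -> hopf_tensor;
  counit : A -> complexStar R;
  antipode : A -> A;
  comult_morphism : star_morphism comult;
  comultE : forall i j, comult (w i j)
    = \sum_k tensl hopf_tensor (w i k) * tensr hopf_tensor (w k j);
  counit_morphism : star_morphism counit;
  counitE : forall i j, counit (w i j) = (i == j)%:R;
  antipode_antimorphism : star_antimorphism antipode;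
  antipodeE : forall i j, antipode (w i j) = w j i
}.

Definition closed_ideal (R : realType) (A : cstarAlg R) (I : set A) : Prop :=
  [/\ I 0, forall a b, I a -> I b -> I (a + b),
      forall a x b, I x -> I (a * x * b) &
      forall a, (forall e : R, 0 < e -> exists2 b, I b & cnorm (a - b) < e) ->
        I a].

(* The relations T v^(x)k = v^(x)l T, entrywise, for T in Hom(w^(x)k, w^(x)l) *)
Definition tannakian_relations (R : realType) (N : nat) (S A : starAlg R)
    (v : 'M[S]_N) (w : 'M[A]_N) : set S :=
  [set x | exists k l T p q, Hom w k l T /\ x = hom_defect v T p q].

(* Comultiplication, counit and antipode of G being given on generators by the
   same formulas as for S_N^+, the quotient map [qsg_quo] intertwines them.  The
   field [qsg_full] says that C(G) is the full version of the algebra. *)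
Record quantumSubgroup (R : realType) (N : nat) (S : cstarAlg R)
    (v : 'M[S]_N) := QuantumSubgroup {
  qsg_alg :> cstarAlg R;
  qsg_quo : S -> qsg_alg;
  qsg_quo_morphism : star_morphism qsg_quo;
  qsg_quo_surj : forall a, exists s, qsg_quo s = a;
  qsg_hopf : hopfStructure (map_mx qsg_quo v);
  qsg_full : qsg_quo @^-1` [set 0] =
    smallest (@closed_ideal R S) (tannakian_relations v (map_mx qsg_quo v))
}.

Definition fundamental (R : realType) (N : nat) (S : cstarAlg R) (v : 'M[S]_N)
    (G : quantumSubgroup v) : 'M[G]_N := map_mx (@qsg_quo _ _ _ _ G) v.

(* Main.v *)
Require Import Defs.
From HB Require Import structures.
From mathcomp Require Import all_boot all_order all_algebra.
From mathcomp Require Import complex.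
From mathcomp Require Import all_classical all_reals topology normedtype.
From mathcomp Require Import sequences.
Set Implicit Arguments. Unset Strict Implicit. Unset Printing Implicit Defensive.
Import Order.TTheory GRing.Theory Num.Theory.
Import numFieldNormedType.Exports.
Local Open Scope classical_set_scope.
Local Open Scope ring_scope.
Local Open Scope complex_scope.

(* Two points need care.  The Tannakian ideal is the closed ideal generated by
   the relations, so the map C(S_N^+) -> M_N(C(X_G)) given by universality
   descends to C(G) only because its kernel is norm closed; evaluating at points
   of X_G, this reduces to *-morphisms A -> M_N(C).  And rho(a)(y) =
   pi_G(a)(f(y)), clear for generators, extends to all of C(G) by the uniqueness
   part of universality, applied to rho and to the pullback of pi_G along f. *)

(** * Unital *-homomorphisms and magic matrices *)

Section StarMorphisms.
Variable R : realType.
Implicit Types A B C : starAlg R.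

Lemma star_morphism0 A B (f : A -> B) : star_morphism f -> f 0 = 0.
Proof. by case=> fB _ _ _; rewrite -[X in f X](subrr 0) fB subrr. Qed.

Lemma star_morphismD A B (f : A -> B) : star_morphism f ->
  {morph f : a b / a + b}.
Proof.
move=> fm a b; have [fB _ _ _] := fm.
by rewrite -[in LHS](opprK b) fB -[- b]add0r fB star_morphism0 // sub0r opprK.
Qed.

Lemma star_morphism_sum A B (f : A -> B) (I : finType) (F : I -> A) :
  star_morphism f -> f (\sum_i F i) = \sum_i f (F i).
Proof.
by move=> fm; exact: (big_morph _ (star_morphismD fm) (star_morphism0 fm)).
Qed.

Lemma star_morphism_comp A B C (f : A -> B) (g : B -> C) :
  star_morphism f -> star_morphism g -> star_morphism (g \o f).
Proof.
move=> [fB [f1 fM] fZ fS] [gB [g1 gM] gZ gS]; split.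
- by move=> a b; rewrite /= fB gB.
- by split => [|a b]; rewrite /= ?f1 ?g1 // fM gM.
- by move=> c; rewrite /= fZ gZ.
- by move=> a; rewrite /= fS gS.
Qed.

Lemma is_magic_morphism N A B (f : A -> B) (v : 'M[A]_N) :
  star_morphism f -> is_magic v -> is_magic (map_mx f v).
Proof.
move=> fm [vp vr vc]; have [_ [f1 fM] _ fS] := fm; split.
- by move=> i j; have [vM vS] := vp i j; rewrite mxE; split; [rewrite -fM vM|rewrite -fS vS].
- move=> i; rewrite -f1 -(vr i) star_morphism_sum //.
  by apply: eq_bigr => j _; rewrite mxE.
- move=> j; rewrite -f1 -(vc j) star_morphism_sum //.
  by apply: eq_bigr => i _; rewrite mxE.
Qed.

(** Both maps are factorizations of the magic matrix [map_mx f v]. *)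
Lemma universal_magic_ext N (S B : cstarAlg R) (v : 'M[S]_N) (f g : S -> B) :
  universal_magic v -> star_morphism f -> star_morphism g ->
  (forall i j, f (v i j) = g (v i j)) -> f = g.
Proof.
move=> [vm vu] fm gm fg.
have [h [_ hu]] := vu _ _ (is_magic_morphism fm vm).
by transitivity h; [symmetry|]; apply: hu; split => // i j; rewrite mxE.
Qed.

End StarMorphisms.

(** * Geometric series in a C*-algebra *)

Section NeumannSeries.
Variables (R : realType) (A : cstarAlg R).
Implicit Types a b d : A.

Lemma cnorm0 : cnorm (0 : A) = 0.
Proof. by have := cnormZ 0 (0 : A); rewrite mulr0 modc0 mul0r. Qed.

Lemma cnormN a : cnorm (- a) = cnorm a.
Proof.
have [sB [s1 sM]] := (@scal_zmod_morphism _ A, @scal_monoid_morphism _ A).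
have s0 : scal 0 = 0 :> A by rewrite -[X in scal X](subrr 0) sB subrr.
have -> : - a = scal (-1) * a.
  by rewrite -[-1 in RHS]sub0r sB s0 s1 sub0r mulN1r.
by rewrite cnormZ modcN /modc normr1 mul1r.
Qed.

Lemma cnorm_ge0 a : 0 <= cnorm a.
Proof.
have := cnormD a (- a); rewrite subrr cnorm0 cnormN -mulr2n.
by rewrite pmulrn_lge0.
Qed.

Lemma cnormX_le d n : cnorm (d ^+ n) <= cnorm (1 : A) * cnorm d ^+ n.
Proof.
elim: n => [|n IH]; first by rewrite !expr0 mulr1.
rewrite !exprSr mulrA (le_trans (cnormM _ _)) //.
by rewrite ler_wpM2r ?cnorm_ge0.
Qed.

(** The partial sums [u n] of the powers of [d] are Cauchy, and their limit is the inverse. *)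
Lemma neumann_series d : cnorm d < 1 -> exists l, (1 - d) * l = 1.
Proof.
set r := cnorm d => r1; have r0 : 0 <= r := cnorm_ge0 d.
pose K := cnorm (1 : A); have K0 : 0 <= K := cnorm_ge0 1.
have q0 : 0 < 1 - r by rewrite subr_gt0.
pose u n := \sum_(i < n) d ^+ i.
have uE n : (1 - d) * u n = 1 - d ^+ n.
  by apply: oppr_inj; rewrite -mulNr !opprB subrX1.
have rn e : 0 < e -> exists n, forall p, (n <= p)%N -> K * r ^+ p < e.
  (* In the zero algebra K = 0, hence the divisor K + 1. *)
  move=> e0; have e'0 : 0 < e / (K + 1) by rewrite divr_gt0 // ltr_wpDl.
  have /(@cvg_expr R) /cvgr0Pnorm_lt /(_ _ e'0) [n _ Hn] : `|r| < 1.
    by rewrite ger0_norm.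
  exists n => p np; have := Hn p np; rewrite /= ger0_norm ?exprn_ge0 //.
  rewrite ltr_pdivlMr ?ltr_wpDl //; apply: le_lt_trans.
  by rewrite mulrC ler_wpM2l ?exprn_ge0 // lerDl.
(* The factor 1 - r makes the tail telescope: induction on q - p gives the sharper bound K r^p - K
   r^q. *)
have ule p q : (p <= q)%N -> (1 - r) * cnorm (u q - u p) <= K * r ^+ p.
  move=> /subnK <-; rewrite addnC.
  apply: (@le_trans _ _ (K * r ^+ p - K * r ^+ (p + (q - p)))); last first.
    by rewrite gerBl mulr_ge0 ?exprn_ge0.
  elim: (q - p)%N => [|m IH]; first by rewrite addn0 !subrr cnorm0 mulr0.
  rewrite addnS {1}/u big_ord_recr /= -/(u _) addrAC.
  apply: (le_trans (ler_wpM2l (ltW q0) (cnormD _ _))).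
  rewrite mulrDr (le_trans (lerD IH (ler_wpM2l (ltW q0) (cnormX_le _ _)))) //.
  rewrite -/K -/r mulrBl mul1r exprS [r * (K * _)]mulrCA -/r.
  by rewrite addrA subrK.
have [l Hl] : exists l, forall e, 0 < e ->
    exists n, forall p, (n <= p)%N -> cnorm (u p - l) < e.
  apply: cnorm_complete => e e0; have qe : 0 < (1 - r) * e by rewrite mulr_gt0.
  have [n Hn] := rn _ qe; exists n => p q np nq.
  wlog pq : p q np nq / (q <= p)%N.
    move=> H; have [|/ltnW] := leqP q p; first exact: H.
    by move=> pq; rewrite -cnormN opprB; exact: H.
  by rewrite -(ltr_pM2l q0) (le_lt_trans (ule _ _ pq)) ?Hn.
exists l; apply/eqP; rewrite -subr_eq0; apply/eqP/cnorm0_eq0/eqP.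
rewrite eq_le cnorm_ge0 andbT; apply/ler_addgt0Pr => e e0; rewrite add0r.
have e20 : 0 < e / 2 by rewrite divr_gt0.
pose M := cnorm (1 - d) + 1.
have M0 : 0 < M by rewrite ltr_wpDl ?cnorm_ge0.
have [n Hn] := rn _ e20; have [m Hm] := Hl _ (divr_gt0 e20 M0).
pose p := maxn n m.
(* By [uE]; each of the two summands has norm at most e / 2. *)
have -> : (1 - d) * l - 1 = - ((1 - d) * (u p - l) + d ^+ p).
  by rewrite mulrBr uE addrAC subrK opprB.
rewrite cnormN (le_trans (cnormD _ _)) // (splitr e) lerD //; last first.
  by rewrite (le_trans (cnormX_le _ _)) // ltW // Hn // leq_maxl.
apply: (le_trans (cnormM _ _)).
have /ltW := Hm p (leq_maxr _ _); rewrite ler_pdivlMr // mulrC.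
apply: le_trans; by rewrite ler_wpM2r ?cnorm_ge0 // lerDl.
Qed.

End NeumannSeries.

(** * Closedness of kernels of matrix-valued morphisms *)

Section MatrixKernel.
Variables (R : realType) (N : nat).
Implicit Types H a : 'M[R[i]]_N.

(** The j-th diagonal entry of a* a is the squared norm of column j of a. *)
Lemma mxstar_mul_eq0 a : mxstar a * a = 0 -> a = 0.
Proof.
move=> aa; apply/matrixP => i j; rewrite mxE; apply: modc0_eq0.
have : vnorm (col j a) = 0.
  apply/eqP; rewrite -sqrf_eq0; apply/eqP/complexI; rewrite -dot_self.
  have /matrixP/(_ j j) := aa; rewrite !mxE => ajj.
  apply: etrans ajj; apply: eq_bigr => k _.
  by rewrite !mxE mulrC.
move=> v0; apply/eqP; rewrite eq_le modc_ge0 -v0.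
by have := modc_le_vnorm (col j a) i; rewrite mxE => ->.
Qed.

(** Raise the exponent to 2^n and halve it repeatedly: H^2 is again hermitian, and H^2 = H* H = 0
    forces H = 0. *)
Lemma hermitian_nilpotent_eq0 H n : mxstar H = H -> H ^+ n = 0 -> H = 0.
Proof.
move=> HS Hn.
have : H ^+ (2 ^ n) = 0.
  by rewrite -(subnK (ltnW (ltn_expl n (isT : 1 < 2)%N))) exprD Hn mulr0.
elim: n H HS {Hn} => [|n IH] H HS; first by rewrite expn0 expr1.
rewrite expnS exprM => /(IH (H ^+ 2)) H2.
by apply: mxstar_mul_eq0; rewrite HS -expr2 H2 // mxstarM HS.
Qed.

(** The characteristic polynomial splits over C with all roots 0, so it is a power of X and
    Cayley-Hamilton applies. In size 0 every matrix is 0. *)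
Lemma eigenvalue0_nilpotent H :
  (forall z, eigenvalue H z -> z = 0) -> exists n, H ^+ n = 0.
Proof.
case: N H => [|m] H Hz; first by exists 0%N; rewrite [LHS]flatmx0 [RHS]flatmx0.
have [r] := closed_field_poly_normal (char_poly H).
rewrite (monicP (char_poly_monic H)) scale1r => cE.
have r0 z : z \in r -> z = 0.
  by move=> zr; apply: Hz; rewrite eigenvalue_root_char cE root_prod_XsubC.
exists (size r); have := Cayley_Hamilton H; rewrite cE.
rewrite big_seq (eq_bigr (fun _ => 'X)) => [|z /r0 ->]; last by rewrite subr0.
by rewrite -big_seq big_const_seq count_predT iter_mulr_1 rmorphXn /= horner_mx_X.
Qed.

(* A hermitian value [phi h] with [h] in the closure of the kernel has no
   nonzero eigenvalue [z]: choosing [b] in the kernel with [|h - b| < |z|], the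
   Neumann series inverts [z - (h - b)], which [phi] maps to [z - phi h]. *)
Lemma closed_ideal_mx_kernel (A : cstarAlg R) (phi : A -> matrixStar R N) :
  star_morphism phi -> closed_ideal (phi @^-1` [set 0]).
Proof.
move=> pm; have [pB [p1 pM] pZ pS] := pm.
split => /=; first exact: (star_morphism0 pm).
- by move=> a b a0 b0; rewrite (star_morphismD pm) a0 b0 addr0.
- by move=> a x b x0; rewrite !pM x0 mulr0 mul0r.
move=> a Ha; apply: mxstar_mul_eq0; pose h := star a * a.
have -> : mxstar (phi a) * phi a = phi h by rewrite pM pS.
have hS : mxstar (phi h) = phi h.
  by rewrite -[LHS]pS /h starM starK.
(* Left multiplication by [star a] carries approximations of [a] in the kernel to approximations of
   [h]. *)
have Hh e : 0 < e -> exists2 b, phi b = 0 & cnorm (h - b) < e.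
  move=> e0; pose M := cnorm (star a) + 1.
  have M0 : 0 < M by rewrite ltr_wpDl ?cnorm_ge0.
  have [b b0 ab] := Ha _ (divr_gt0 e0 M0); exists (star a * b).
    by rewrite pM b0 mulr0.
  rewrite -mulrBr (le_lt_trans (cnormM _ _)) //.
  move: ab; rewrite ltr_pdivlMr // mulrC; apply: le_lt_trans.
  by rewrite ler_wpM2r ?cnorm_ge0 // lerDl.
suff [n] : exists n, (phi h : 'M_N) ^+ n = 0 by exact: hermitian_nilpotent_eq0.
apply: eigenvalue0_nilpotent => z /eigenvalueP[x xh xn0].
apply/eqP; apply: contraNT xn0 => zn0; apply/eqP.
have mz : 0 < modc z.
  by rewrite lt_neqAle modc_ge0 andbT eq_sym; apply: contra zn0 => /eqP/modc0_eq0/eqP.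
have [b b0 hb] := Hh _ mz.
have [l] : exists l, (1 - scal z^-1 * (h - b)) * l = 1.
  apply: neumann_series; rewrite cnormZ.
  rewrite -(ltr_pM2l mz) mulrA -modcM divff // {1}/modc normr1 mul1r mulr1.
  exact: hb.
move=> /(congr1 phi); rewrite pM p1 pB p1 pM pB b0 subr0 pZ => E.
(* As [x] is a left eigenvector, a right inverse suffices: x = x (1 - z^-1 phi h) (phi l) = 0. *)
rewrite -[x]mulmx1 -[1%:M]/(1 : matrixStar R N) -E.
rewrite -[_ * phi l]/(_ *m phi l) mulmxA mulmxBr mulmx1.
rewrite -[_ * phi h]/(_%:M *m phi h) mul_scalar_mx -scalemxAr xh scalerA.
by rewrite mulVf // scale1r subrr mul0mx.
Qed.

(** The kernel is the intersection of the kernels of the point evaluations. *)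
Lemma closed_ideal_kernel (A : cstarAlg R) (X : topologicalType)
    (phi : A -> mxCStar R N X) :
  star_morphism phi -> closed_ideal (phi @^-1` [set 0]).
Proof.
move=> pm.
have ker (a : A) : phi a = 0 <-> forall x, mxeval (phi a) x = 0.
  split=> [-> x|H]; first by apply/matrixP => i j; rewrite !mxE.
  by apply: mxevalP => x; rewrite H; apply/matrixP => i j; rewrite !mxE.
have cK x := closed_ideal_mx_kernel (star_morphism_comp pm (mxeval_morphism R N x)).
split => /=.
- by apply/ker => x; have [] := cK x.
- move=> a b /ker a0 /ker b0; apply/ker => x.
  by have [_ KD _ _] := cK x; exact: (KD _ _ (a0 x) (b0 x)).
- move=> a y b /ker y0; apply/ker => x.
  by have [_ _ KM _] := cK x; exact: (KM _ _ _ (y0 x)).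
- move=> a Ha; apply/ker => x; have [_ _ _ KC] := cK x; apply: KC => e /Ha[b /ker b0 ab].
  by exists b => //; exact: b0.
Qed.

End MatrixKernel.

(** * Factorization through quotients, and pullback of functions *)

Section StarMorphismConstructions.
Variable R : realType.

(** Compose [phi] with a set-theoretic section of [q]; the choice of preimage is immaterial, since
    two preimages differ by an element that [phi] kills. *)
Lemma star_morphism_factor (S A B : starAlg R) (q : S -> A) (phi : S -> B) :
  star_morphism q -> star_morphism phi -> (forall a, exists s, q s = a) ->
  (forall s, q s = 0 -> phi s = 0) ->
  exists2 pi : A -> B, star_morphism pi & forall s, pi (q s) = phi s.
Proof.
move=> [qB [q1 qM] qZ qS] pm /choice[r qr] ker.
have [pB [p1 pM] pZ pS] := pm.
have pi_q s : phi (r (q s)) = phi s.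
  apply/eqP; rewrite -subr_eq0 -pB; apply/eqP/ker.
  by rewrite qB qr subrr.
exists (phi \o r) => //; split.
- by move=> a b; rewrite /= -[in LHS](qr a) -[in LHS](qr b) -qB pi_q pB.
- split=> [|a b]; first by rewrite /= -q1 pi_q p1.
  by rewrite /= -[in LHS](qr a) -[in LHS](qr b) -qM pi_q pM.
- by move=> c; rewrite /= -qZ pi_q pZ.
- by move=> a; rewrite /= -[in LHS](qr a) -qS pi_q pS.
Qed.

Section Pullback.
Variables (N : nat) (X Y : topologicalType) (f : Y -> X).
Hypothesis fc : continuous f.

Let comp_cts (g : continuousType X R[i]) : continuous (g \o f).
Proof. by move=> y; apply: continuous_comp; [exact: fc|exact: cts_fun]. Qed.

Definition mxC_pullback (a : mxCStar R N X) : mxCStar R N Y :=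
  map_mx (fun g => mkcts (@comp_cts g) : continuousType Y R[i]) a.

Lemma mxeval_pullback (a : mxCStar R N X) y :
  mxeval (mxC_pullback a) y = mxeval a (f y).
Proof. by apply/matrixP => i j; rewrite !mxE. Qed.

Lemma mxC_pullback_morphism : star_morphism mxC_pullback.
Proof.
split.
- by move=> a b; apply: mxevalP => y; rewrite mxevalB !mxeval_pullback mxevalB.
- split=> [|a b]; apply: mxevalP => y; first by rewrite mxeval_pullback !mxeval1.
  by rewrite mxevalM !mxeval_pullback mxevalM.
- by move=> c; apply: mxevalP => y; rewrite mxeval_pullback !mxeval_scal.
- by move=> a; apply: mxevalP => y; rewrite mxeval_star !mxeval_pullback mxeval_star.
Qed.

End Pullback.

End StarMorphismConstructions.

(** * The tautological model over X_G *)

Section UniversalModel.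
Variables (R : realType) (N : nat).

(** Morphisms commute with [hom_defect], so intertwiners of [w] survive in the image. This supplies
    the points f(y). *)
Lemma XG_morphism (A : starAlg R) (w : 'M[A]_N) (rho : A -> matrixStar R N) :
  star_morphism rho -> is_magic w -> (forall i j, rank1_projection (rho (w i j))) ->
  XG w (map_mx rho w).
Proof.
move=> rm wm r1; split.
  by split=> [|i j]; [exact: is_magic_morphism|rewrite mxE].
move=> k l T /HomE T0; apply/HomE => p q.
by rewrite hom_defect_morph // T0 star_morphism0.
Qed.

Section Tautological.
Variables (A : starAlg R) (w : 'M[A]_N).
Local Notation X := (XG_space w).

Let entry_cts i j a b : continuous (fun u : X => (\val u) i j a b).
Proof.
move=> u; have vc : {for u, continuous (\val : X -> 'M['M[R[i]]_N]_N)}.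
  exact: (@initial_continuous _ _ (\val : X -> 'M['M[R[i]]_N]_N)).
apply: (@continuous_comp _ _ _ (fun u : X => (\val u) i j) (fun p => p a b)).
  apply: (@continuous_comp _ _ _ (\val : X -> _) (fun u => u i j)) => //.
  exact: coord_mx_continuous.
exact: coord_mx_continuous.
Qed.

(** The inclusion of X_G into X_N, read as a matrix over M_N(C(X_G)): the prescribed images of the
    generators. *)
Definition tautological_magic : 'M[mxC R N X]_N :=
  \matrix_(i, j) \matrix_(a, b)
    (mkcts (@entry_cts i j a b) : continuousType X R[i]).

Lemma mxeval_tautological i j u : mxeval (tautological_magic i j) u = (\val u) i j.
Proof. by apply/matrixP => a b; rewrite !mxE. Qed.

Lemma map_tautological u :
  map_mx (fun a => mxeval a u) tautological_magic = \val u.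
Proof. by apply/matrixP => i j; rewrite mxE mxeval_tautological. Qed.

Lemma XG_val (u : X) : XG w (\val u).
Proof. exact: (set_mem (valP u)). Qed.

Lemma is_magic_tautological : is_magic tautological_magic.
Proof.
have ev_sum (I : finType) (F : I -> mxC R N X) u :
    mxeval (\sum_i F i) u = \sum_i mxeval (F i) u.
  exact: (star_morphism_sum F (mxeval_morphism R N u)).
split.
- move=> i j; split; apply: mxevalP => u; have [[[uP _ _] _] _] := XG_val u;
    have [uM uS] := uP i j.
    by rewrite mxevalM !mxeval_tautological; exact: uM.
  by rewrite mxeval_star !mxeval_tautological; exact: uS.
- move=> i; apply: mxevalP => u; have [[[_ ur _] _] _] := XG_val u.
  rewrite ev_sum mxeval1 -[RHS](ur i).
  by apply: eq_bigr => j _; rewrite mxeval_tautological.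
- move=> j; apply: mxevalP => u; have [[[_ _ uc] _] _] := XG_val u.
  rewrite ev_sum mxeval1 -[RHS](uc j).
  by apply: eq_bigr => i _; rewrite mxeval_tautological.
Qed.

(** At each point u this is the Tannakian condition defining X_G. *)
Lemma hom_defect_tautological k l T p q :
  Defs.Hom w k l T -> hom_defect tautological_magic T p q = 0.
Proof.
move=> TH; apply: mxevalP => u.
rewrite -(hom_defect_morph _ _ _ _ (mxeval_morphism R N u)) map_tautological.
have [_ /(_ _ _ _ TH)/HomE ->] := XG_val u.
by apply/matrixP => a b; rewrite !mxE.
Qed.

End Tautological.

(** Composing with the surjective quotient map reduces this to [universal_magic_ext]. *)
Lemma fundamental_ext (S B : cstarAlg R) (v : 'M[S]_N) (G : quantumSubgroup v)
    (f g : G -> B) :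
  universal_magic v -> star_morphism f -> star_morphism g ->
  (forall i j, f (fundamental G i j) = g (fundamental G i j)) -> f = g.
Proof.
move=> hS fm gm fg; have qm := @qsg_quo_morphism _ _ _ _ G.
have fgq : f \o @qsg_quo _ _ _ _ G = g \o @qsg_quo _ _ _ _ G.
  apply: (universal_magic_ext hS); [exact: star_morphism_comp..|].
  by move=> i j; have := fg i j; rewrite !mxE.
apply/funext => a; have [s <-] := qsg_quo_surj a.
exact: (congr1 (fun h => h s) fgq).
Qed.

Lemma flat_model_exists (S : cstarAlg R) (v : 'M[S]_N) (G : quantumSubgroup v) :
  universal_magic v ->
  exists2 pi_G : G -> mxC R N (XG_space (fundamental G)),
    star_morphism pi_G &
    forall i j u, mxeval (pi_G (fundamental G i j)) u = (\val u) i j.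
Proof.
move=> [_ vu]; have [phi [[pm pv] _]] := vu _ _ (is_magic_tautological (fundamental G)).
have ker s : @qsg_quo _ _ _ _ G s = 0 -> phi s = 0.
  move=> s0; have : (@qsg_quo _ _ _ _ G @^-1` [set 0]) s by [].
  (* By minimality, it is enough that the kernel of [phi] is a closed ideal containing the
     relations. *)
  rewrite qsg_full; apply: (@smallest_sub _ _ _ (phi @^-1` [set 0])).
    exact: closed_ideal_kernel.
  move=> _ [k [l [T [p [q [TH ->]]]]]].
  rewrite /= -hom_defect_morph //.
  have -> : map_mx phi v = tautological_magic (fundamental G).
    by apply/matrixP => i j; rewrite mxE pv.
  exact: hom_defect_tautological.
have [pi_G pim piq] := star_morphism_factor (@qsg_quo_morphism _ _ _ _ G) pm
  (@qsg_quo_surj _ _ _ _ G) ker.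
by exists pi_G => // i j u; rewrite mxE piq pv mxeval_tautological.
Qed.

End UniversalModel.

Theorem theorem6p2 (R : realType) (N : nat) (S : cstarAlg R) (v : 'M[S]_N)
    (hS : universal_magic v) (G : quantumSubgroup v) :
  (exists! pi_G : G -> mxC R N (XG_space (fundamental G)),
     star_morphism pi_G /\
     forall i j (u : XG_space (fundamental G)),
       mxeval (pi_G (fundamental G i j)) u = (\val u) i j) /\
  (forall pi_G : G -> mxC R N (XG_space (fundamental G)),
     star_morphism pi_G ->
     (forall i j (u : XG_space (fundamental G)),
       mxeval (pi_G (fundamental G i j)) u = (\val u) i j) ->
     forall (Y : compactType) (rho : G -> mxC R N Y),
       star_morphism rho ->
       (forall i j y, rank1_projection (mxeval (rho (fundamental G i j)) y)) ->
       exists! f : Y -> XG_space (fundamental G),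
         continuous f /\
         forall a y, mxeval (rho a) y = mxeval (pi_G a) (f y)).
Proof.
split.
  have [pi_G pim piE] := flat_model_exists G hS.
  exists pi_G; split=> // pi' [pim' piE'].
  apply: (fundamental_ext hS) => // i j.
  by apply: mxevalP => u; rewrite piE piE'.
move=> pi_G pim piE Y rho rm r1.
set w := fundamental G in piE r1 *.
have wm : is_magic w by apply: is_magic_morphism hS.1; exact: qsg_quo_morphism.
have ym y := star_morphism_comp rm (mxeval_morphism R N y).
have XGy y : XG w (map_mx (fun a => mxeval (rho a) y) w).
  by apply: XG_morphism (ym y) wm _ => i j; exact: r1.
pose f y : XG_space w := SigSub (mem_set (XGy y)).
have fc : continuous f.
  (* X_G carries the subspace topology, so continuity is checked on scalar entries, which are those
     of rho(w_ij). *)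
  apply: continuous_comp_initial.
  apply: mx_continuous => i j; apply: mx_continuous => a b.
  have -> : (fun y => (set_val \o f) y i j a b) = rho (w i j) a b.
    by apply/funext => y; rewrite /= !mxE.
  exact: cts_fun.
exists f; split.
  split=> // a y.
  suff -> : rho = mxC_pullback fc \o pi_G by rewrite mxeval_pullback.
  apply: (fundamental_ext hS) => //.
    exact: (star_morphism_comp pim (mxC_pullback_morphism R N fc)).
  by move=> i j; apply: mxevalP => z; rewrite mxeval_pullback piE /= [RHS]mxE.
(* Taking a = w_ij in [gE] determines every entry of g(y). *)
move=> g [gc gE]; apply/funext => y; apply/val_inj/matrixP => i j.
by rewrite -[RHS]piE -gE /= mxE.
Qed.
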